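(* Let $I\subseteq\mathbb{R}$ be an open interval, let $K$ be $\mathbb{R}$ or $\mathbb{C}$, and let $B,C,R:I\to K$ be functions, with $B$ differentiable, such that for all $x\in I$ $$B(x)^2+2B'(x)-4C(x)=0.$$ Let $c\in K$ be any constant such that $x+c\neq 0$ for all $x\in I$, and assume that the indefinite integral $\int (x+c)e^{\int\frac{B(x)}{2}\,dx}R(x)\,dx$ exists on $I$. Then the general solution on $I$ of $$y''+B(x)y'+C(x)y=R(x)$$ is $$y=(x+c)e^{-\int\frac{B(x)}{2}\,dx}\int\frac{1}{(x+c)^2}\left(\int (x+c)e^{\int\frac{B(x)}{2}\,dx}R(x)\,dx\right)dx+C_1e^{-\int\frac{B(x)}{2}\,dx}+C_2\,x\,e^{-\int\frac{B(x)}{2}\,dx},$$ where $C_1,C_2\in K$ are arbitrary constants; that is, a twice differentiable function $y:I\to K$ satisfies the differential equation on $I$ if and only if it has this form for some $C_1,C_2\in K$.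
   Context: An indefinite integral $\int u(x)\,dx$ of a function $u$ on $I$ denotes one fixed (arbitrarily chosen) antiderivative of $u$ on $I$, i.e. a differentiable function $U$ with $U'=u$ on $I$; each time the same integral occurs the same antiderivative is used. The arbitrary constants of integration are displayed explicitly as $C_1,C_2$. *)

(* Defs.v *)
From Stdlib Require Export Reals.
From Coquelicot Require Export Coquelicot.

Open Scope R_scope.

(** Functions on an open interval [I] with values in K (K the reals or the
    complex numbers) are total functions [R -> K] of which only the values on
    [I] matter; [I] being open, so do the derivatives at the points of [I]. *)

(** Infinite endpoints are allowed; empty unless [a < b]. *)
Definition Rbar_ointerval (a b : Rbar) (x : R) : Prop :=
  Rbar_lt a x /\ Rbar_lt x b.

(** [df] is the derivative of [f] on [I]; equivalently, [f] is an
    antiderivative of [df] on [I].  For K = C take [V := C_R_NormedModule],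
    the complex numbers as a real normed space: the variable is real. *)
Definition has_derivative_on (V : NormedModule R_AbsRing) (I : R -> Prop)
    (f df : R -> V) : Prop :=
  forall x : R, I x -> is_derive f x (df x).

Definition Cexp (z : C) : C :=
  (RtoC (exp (Re z)) * (cos (Im z), sin (Im z)))%C.

(** [y] is twice differentiable on [I] and [y'' + B y' + Q y = F] there. *)
Definition solves_real (I : R -> Prop) (B Q F y : R -> R) : Prop :=
  exists dy ddy : R -> R,
    has_derivative_on R_NormedModule I y dy /\
    has_derivative_on R_NormedModule I dy ddy /\
    forall x : R, I x -> ddy x + B x * dy x + Q x * y x = F x.

Definition solves_complex (I : R -> Prop) (B Q F y : R -> C) : Prop :=
  exists dy ddy : R -> C,
    has_derivative_on C_R_NormedModule I y dy /\
    has_derivative_on C_R_NormedModule I dy ddy /\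
    forall x : R, I x -> (ddy x + B x * dy x + Q x * y x = F x)%C.

(* Main.v *)
(* Put y = e^(-P) u with P' = B/2.  The hypothesis on B and C says exactly that
   the coefficient of u in the transformed equation vanishes, leaving
   u'' = e^P R.  With G' = (x+c) e^P R and S' = G/(x+c)^2, the function (x+c) S
   solves this, its derivative being S + G/(x+c); two solutions differ by a
   function with zero second derivative on an interval, i.e. C1 + C2 x.
   The real case follows from the complex one by taking real parts. *)
Require Import Defs.
From Stdlib Require Import Reals Lra Classical.
From Coquelicot Require Import Coquelicot.
Open Scope R_scope.

(** * Differential calculus for complex-valued functions of a real variable *)

Notation is_derive_RC := (@is_derive R_AbsRing C_R_NormedModule).
Notation is_derive_RR := (@is_derive R_AbsRing R_NormedModule).

(** [Re] and [Im] are continuous linear maps; conversely [z = Re z * 1 + Im z * i]. This reduces the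
    rules for products, exponentials and inverses to real calculus. *)
Lemma is_derive_RC_iff (f : R -> C) (x : R) (l : C) :
  is_derive_RC f x l <->
  is_derive_RR (fun t => Re (f t)) x (Re l) /\
  is_derive_RR (fun t => Im (f t)) x (Im l).
Proof.
  split.
  - intros Hf; split.
    + apply (filterdiff_comp (W := R_NormedModule)) with (1 := Hf) (g := Re)
        (lg := Re).
      apply filterdiff_linear, (is_linear_fst (U := R_NormedModule)
        (V := R_NormedModule)).
    + apply (filterdiff_comp (W := R_NormedModule)) with (1 := Hf) (g := Im)
        (lg := Im).
      apply filterdiff_linear, (is_linear_snd (U := R_NormedModule)
        (V := R_NormedModule)).
  - intros [H1 H2].
    pose proof (is_derive_plus (V := C_R_NormedModule) _ _ x _ _
      (is_derive_scal_l (V := C_R_NormedModule) _ x _ (RtoC 1) H1)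
      (is_derive_scal_l (V := C_R_NormedModule) _ x _ Ci H2)) as H.
    assert (E : forall z : C,
      @plus C_R_NormedModule (@scal R_Ring C_R_NormedModule (Re z) (RtoC 1))
        (@scal R_Ring C_R_NormedModule (Im z) Ci) = z).
    { intros [u v]; apply injective_projections;
        cbv -[Rplus Rmult R1 R0 IZR]; ring. }
    rewrite E in H.
    apply is_derive_ext with (2 := H); intros t; apply E.
Qed.

(** [auto_derive] states its result through [Derive] of the abstract functions; the [is_derive]
    hypotheses supply these values. The final [change] puts the equality back at type [R] for [ring]
    and [field]. *)
Ltac auto_derive_from_hyps :=
  auto_derive;
  [ repeat split; try (eexists; eassumption); auto
  | repeat match goal with
    | H : is_derive ?f _ _ |- _ =>
        try rewrite (is_derive_unique (fun t : R => f t) _ _ H); clear H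
    end;
    match goal with |- ?u = ?v => change (@eq R u v) end ].

(** Lets a derivative be assembled by the rules first and brought to the wanted form by algebra
    afterwards. *)
Lemma is_derive_RC_eq (f : R -> C) (x : R) (l l' : C) :
  is_derive_RC f x l -> l = l' -> is_derive_RC f x l'.
Proof. now intros H <-. Qed.

Lemma is_derive_RC_plus (f g : R -> C) (x : R) (df dg : C) :
  is_derive_RC f x df -> is_derive_RC g x dg ->
  is_derive_RC (fun t => (f t + g t)%C) x (df + dg)%C.
Proof. apply (is_derive_plus (V := C_R_NormedModule)). Qed.

Lemma is_derive_RC_minus (f g : R -> C) (x : R) (df dg : C) :
  is_derive_RC f x df -> is_derive_RC g x dg ->
  is_derive_RC (fun t => (f t - g t)%C) x (df - dg)%C.
Proof. apply (is_derive_minus (V := C_R_NormedModule)). Qed.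

Lemma is_derive_RC_opp (f : R -> C) (x : R) (df : C) :
  is_derive_RC f x df -> is_derive_RC (fun t => (- f t)%C) x (- df)%C.
Proof. apply (is_derive_opp (V := C_R_NormedModule)). Qed.

Lemma is_derive_RC_const (k : C) (x : R) :
  is_derive_RC (fun _ => k) x (RtoC 0).
Proof. apply (is_derive_const (V := C_R_NormedModule)). Qed.

Lemma is_derive_RC_RtoC (f : R -> R) (x df : R) :
  is_derive_RR f x df -> is_derive_RC (fun t => RtoC (f t)) x (RtoC df).
Proof.
  intros H; apply is_derive_RC_iff; split; [exact H|].
  apply (is_derive_const (V := R_NormedModule) 0).
Qed.

Lemma is_derive_RC_id (x : R) : is_derive_RC RtoC x (RtoC 1).
Proof.
  apply (is_derive_RC_RtoC (fun t => t)), (is_derive_id (K := R_AbsRing)).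
Qed.

Lemma is_derive_RC_mult (f g : R -> C) (x : R) (df dg : C) :
  is_derive_RC f x df -> is_derive_RC g x dg ->
  is_derive_RC (fun t => (f t * g t)%C) x (df * g x + f x * dg)%C.
Proof.
  intros [Hf1 Hf2]%is_derive_RC_iff [Hg1 Hg2]%is_derive_RC_iff.
  apply is_derive_RC_iff; unfold Re, Im in *; simpl.
  set (f1 := fun t => fst (f t)); set (f2 := fun t => snd (f t)).
  change (is_derive_RR f1 x (fst df)) in Hf1.
  change (is_derive_RR f2 x (snd df)) in Hf2.
  set (g1 := fun t => fst (g t)); set (g2 := fun t => snd (g t)).
  change (is_derive_RR g1 x (fst dg)) in Hg1.
  change (is_derive_RR g2 x (snd dg)) in Hg2.
  change (is_derive_RR (fun t => f1 t * g1 t - f2 t * g2 t) x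
    (fst df * g1 x - snd df * g2 x + (f1 x * fst dg - f2 x * snd dg)) /\
    is_derive_RR (fun t => f1 t * g2 t + f2 t * g1 t) x
    (fst df * g2 x + snd df * g1 x + (f1 x * snd dg + f2 x * fst dg))).
  (* Once opaque, the components are plain unknown real functions for [auto_derive]. *)
  clearbody f1 f2 g1 g2.
  split; auto_derive_from_hyps; ring.
Qed.

Lemma is_derive_RC_Cexp (f : R -> C) (x : R) (df : C) :
  is_derive_RC f x df ->
  is_derive_RC (fun t => Cexp (f t)) x (df * Cexp (f x))%C.
Proof.
  intros [Hf1 Hf2]%is_derive_RC_iff.
  apply is_derive_RC_iff; unfold Re, Im, Cexp in *; simpl.
  set (f1 := fun t => fst (f t)); set (f2 := fun t => snd (f t)).
  change (is_derive_RR f1 x (fst df)) in Hf1.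
  change (is_derive_RR f2 x (snd df)) in Hf2.
  split.
  (* The terms with factor 0 come from the imaginary part of [RtoC (exp _)]; they are kept so that
     the goal matches by conversion. *)
  - change (is_derive_RR
      (fun t => exp (f1 t) * cos (f2 t) - 0 * sin (f2 t)) x
      (fst df * (exp (f1 x) * cos (f2 x) - 0 * sin (f2 x)) -
       snd df * (exp (f1 x) * sin (f2 x) + 0 * cos (f2 x)))).
    clearbody f1 f2; auto_derive_from_hyps; ring.
  - change (is_derive_RR
      (fun t => exp (f1 t) * sin (f2 t) + 0 * cos (f2 t)) x
      (fst df * (exp (f1 x) * sin (f2 x) + 0 * cos (f2 x)) +
       snd df * (exp (f1 x) * cos (f2 x) - 0 * sin (f2 x)))).
    clearbody f1 f2; auto_derive_from_hyps; ring.
Qed.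

Lemma is_derive_RC_inv (f : R -> C) (x : R) (df : C) :
  is_derive_RC f x df -> f x <> RtoC 0 ->
  is_derive_RC (fun t => (/ f t)%C) x (- df / (f x * f x))%C.
Proof.
  intros [Hf1 Hf2]%is_derive_RC_iff Hnz.
  assert (Hn : fst (f x) ^ 2 + snd (f x) ^ 2 <> 0).
  { intros H; apply Hnz, injective_projections; simpl; nra. }
  (* Inverting each factor separately keeps [f1 ^ 2 + f2 ^ 2] as the only denominator; inverting the
     product would bring in the squared modulus of [f x * f x]. *)
  replace (- df / (f x * f x))%C with (- df * (/ f x * / f x))%C
    by (field; exact Hnz).
  apply is_derive_RC_iff; unfold Re, Im in *; simpl in *.
  set (f1 := fun t => fst (f t)); set (f2 := fun t => snd (f t)).
  change (is_derive_RR f1 x (fst df)) in Hf1.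
  change (is_derive_RR f2 x (snd df)) in Hf2.
  change (fst (f x)) with (f1 x) in *; change (snd (f x)) with (f2 x) in *.
  split.
  - change (is_derive_RR (fun t => f1 t / (f1 t ^ 2 + f2 t ^ 2)) x
      (- fst df * (f1 x / (f1 x ^ 2 + f2 x ^ 2) * (f1 x / (f1 x ^ 2 + f2 x ^ 2))
        - (- f2 x / (f1 x ^ 2 + f2 x ^ 2) * (- f2 x / (f1 x ^ 2 + f2 x ^ 2))))
       - (- snd df) *
       (f1 x / (f1 x ^ 2 + f2 x ^ 2) * (- f2 x / (f1 x ^ 2 + f2 x ^ 2))
        + - f2 x / (f1 x ^ 2 + f2 x ^ 2) * (f1 x / (f1 x ^ 2 + f2 x ^ 2))))).
    clearbody f1 f2; auto_derive_from_hyps; field; simpl in Hn; lra.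
  - change (is_derive_RR (fun t => - f2 t / (f1 t ^ 2 + f2 t ^ 2)) x
      (- fst df *
       (f1 x / (f1 x ^ 2 + f2 x ^ 2) * (- f2 x / (f1 x ^ 2 + f2 x ^ 2))
        + - f2 x / (f1 x ^ 2 + f2 x ^ 2) * (f1 x / (f1 x ^ 2 + f2 x ^ 2)))
       + (- snd df) *
       (f1 x / (f1 x ^ 2 + f2 x ^ 2) * (f1 x / (f1 x ^ 2 + f2 x ^ 2))
        - (- f2 x / (f1 x ^ 2 + f2 x ^ 2) * (- f2 x / (f1 x ^ 2 + f2 x ^ 2)))))).
    clearbody f1 f2; auto_derive_from_hyps; field; simpl in Hn; lra.
Qed.

(** * Algebra of the complex exponential and of the embedding of the reals *)

Lemma Cexp_opp_mult (z : C) : (Cexp (- z) * Cexp z)%C = RtoC 1.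
Proof.
  destruct z as [u v].
  assert (Hexp : exp (- u) * exp u = 1).
  { rewrite <- exp_plus, <- exp_0; f_equal; ring. }
  pose proof (sin2_cos2 v) as Hsc; unfold Rsqr in Hsc.
  unfold Cexp, Cmult, Copp, RtoC, Re, Im; simpl.
  rewrite cos_neg, sin_neg; f_equal.
  - transitivity (exp (- u) * exp u * (sin v * sin v + cos v * cos v));
      [ring | rewrite Hexp, Hsc; ring].
  - ring.
Qed.

Lemma RtoC_neq_0 (x : R) : x <> 0 -> RtoC x <> RtoC 0.
Proof. intros Hx H; now apply Hx, RtoC_inj. Qed.

Lemma Cexp_RtoC (x : R) : Cexp (RtoC x) = RtoC (exp x).
Proof.
  unfold Cexp; simpl; rewrite cos_0, sin_0.
  change (1, 0) with (RtoC 1); ring.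
Qed.

(** * Antiderivatives on an interval, and functions with vanishing derivatives *)

Lemma Rbar_ointerval_convex (a b : Rbar) (u v x : R) :
  Rbar_ointerval a b u -> Rbar_ointerval a b v ->
  Rmin u v <= x <= Rmax u v -> Rbar_ointerval a b x.
Proof.
  intros [Hau Hub] [Hav Hvb] [H1 H2]; split.
  - apply Rbar_lt_le_trans with (Rmin u v); [|exact H1].
    unfold Rmin; destruct (Rle_dec u v); assumption.
  - apply Rbar_le_lt_trans with (Rmax u v); [exact H2|].
    unfold Rmax; destruct (Rle_dec u v); assumption.
Qed.

(** Fundamental theorem of calculus from a base point inside the interval. It provides [P] and [S],
    whose integrands are continuous because [B] and [G] are differentiable; [G] itself is assumed,
    [F] being arbitrary. *)
Lemma antiderivative_exists (a b : Rbar) (V : CompleteNormedModule R_AbsRing)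
    (f : R -> V) :
  (forall x, Rbar_ointerval a b x -> continuous f x) ->
  exists F : R -> V, has_derivative_on V (Rbar_ointerval a b) F f.
Proof.
  intros Hf.
  destruct (classic (exists x0, Rbar_ointerval a b x0)) as [[x0 H0]|Hempty].
  - exists (RInt f x0); intros x Hx.
    apply is_derive_RInt with x0; [|now apply Hf].
    (* Integrability from [x0] is needed up to every [y] near [x]: openness gives the neighbourhood,
       convexity the segment. *)
    apply locally_interval with a b; [apply Hx | apply Hx |].
    intros y Hay Hyb.
    apply (RInt_correct f), ex_RInt_continuous; intros z Hz; apply Hf.
    now apply Rbar_ointerval_convex with x0 y.
  - exists f; intros x Hx; exfalso; eauto.
Qed.

Lemma derivative_zero_constant (a b : Rbar) (V : NormedModule R_AbsRing)
    (f df : R -> V) (x y : R) :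
  has_derivative_on V (Rbar_ointerval a b) f df ->
  (forall t, Rbar_ointerval a b t -> df t = zero) ->
  Rbar_ointerval a b x -> Rbar_ointerval a b y -> f x = f y.
Proof.
  intros Hf Hdf.
  assert (Hlt : forall u v, Rbar_ointerval a b u -> Rbar_ointerval a b v ->
    u < v -> f u = f v).
  { intros u v Hu Hv Huv; apply eq_is_derive; [|exact Huv]; intros t Ht.
    assert (It : Rbar_ointerval a b t).
    { apply Rbar_ointerval_convex with u v; trivial.
      rewrite Rmin_left, Rmax_right; lra. }
    rewrite <- (Hdf t It); now apply Hf. }
  intros Hx Hy; destruct (Rtotal_order x y) as [H|[->|H]]; auto.
  symmetry; auto.
Qed.

Lemma second_derivative_zero_affine (a b : Rbar) (f df ddf : R -> C) :
  has_derivative_on C_R_NormedModule (Rbar_ointerval a b) f df ->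
  has_derivative_on C_R_NormedModule (Rbar_ointerval a b) df ddf ->
  (forall x, Rbar_ointerval a b x -> ddf x = RtoC 0) ->
  exists C1 C2 : C, forall x : R, Rbar_ointerval a b x ->
    f x = (C1 + C2 * x)%C.
Proof.
  intros Hf Hdf Hddf.
  destruct (classic (exists x0, Rbar_ointerval a b x0)) as [[x0 H0]|Hempty].
  2: { exists (RtoC 0), (RtoC 0); intros x Hx; exfalso; eauto. }
  (* The line is the tangent at [x0]: since [df] is constant, [f - df x0 * x] has zero
     derivative. *)
  exists (f x0 - df x0 * x0)%C, (df x0); intros x Hx.
  assert (H : (f x - df x0 * x = f x0 - df x0 * x0)%C).
  { apply (derivative_zero_constant a b C_R_NormedModule
      (fun t => f t - df x0 * t)%C (fun t => df t - df x0)%C); trivial.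
    - intros t Ht.
      apply is_derive_RC_eq with (df t - (0 * t + df x0 * 1))%C; [|ring].
      apply is_derive_RC_minus; [now apply Hf|].
      apply (is_derive_RC_mult (fun _ => df x0)); [apply is_derive_RC_const|].
      apply is_derive_RC_id.
    - intros t Ht.
      rewrite (derivative_zero_constant a b _ df ddf t x0); trivial.
      change ((df x0 - df x0)%C = RtoC 0); ring. }
  rewrite <- H; ring.
Qed.

(** * Reductions of the equation: removal of the first-order term, and passage from real to
    complex *)

(* With [y = e^(-P) u] and [P' = B/2] the left-hand side of the equation is
   [e^(-P) (u'' - (B^2 + 2 B' - 4 Q)/4 u)]. *)
Lemma solves_complex_substitution (I : R -> Prop) (B dB Q F P y : R -> C) :
  has_derivative_on C_R_NormedModule I B dB ->
  (forall x, I x -> ((B x) ^ 2 + 2 * dB x - 4 * Q x = 0)%C) ->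
  has_derivative_on C_R_NormedModule I P (fun x => (B x / 2)%C) ->
  solves_complex I B Q F y <->
  exists du : R -> C,
    has_derivative_on C_R_NormedModule I (fun x => (Cexp (P x) * y x)%C) du /\
    has_derivative_on C_R_NormedModule I du (fun x => (Cexp (P x) * F x)%C).
Proof.
  intros HB HQ HP.
  (* Solving the hypothesis for [Q] lets [field] close the computations below. *)
  assert (HQ' : forall x, I x -> Q x = ((B x * B x + 2 * dB x) / 4)%C).
  { intros x Hx; transitivity
      (((B x) ^ 2 + 2 * dB x - ((B x) ^ 2 + 2 * dB x - 4 * Q x)) / 4)%C.
    - field.
    - rewrite (HQ x Hx); field. }
  split.
  - intros (dy & ddy & Hy & Hdy & Heq).
    exists (fun x => B x / 2 * Cexp (P x) * y x + Cexp (P x) * dy x)%C; split.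
    + intros x Hx; apply is_derive_RC_mult; [|now apply Hy].
      now apply is_derive_RC_Cexp, HP.
    + intros x Hx; eapply is_derive_RC_eq.
      { apply is_derive_RC_plus.
        - apply is_derive_RC_mult; [|now apply Hy].
          apply is_derive_RC_mult; [|now apply is_derive_RC_Cexp, HP].
          apply is_derive_RC_mult; [now apply HB | apply is_derive_RC_const].
        - apply is_derive_RC_mult; [|now apply Hdy].
          now apply is_derive_RC_Cexp, HP. }
      cbv beta; rewrite <- (Heq x Hx), (HQ' x Hx).
      field.
  - intros (du & Hu & Hdu).
    set (u := fun x => (Cexp (P x) * y x)%C) in Hu.
    set (e := fun x => Cexp (- P x)).
    assert (He : forall x, I x -> is_derive_RC e x (- (B x / 2) * e x)%C).
    { intros x Hx; apply is_derive_RC_Cexp, is_derive_RC_opp.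
      now apply HP. }
    (* This holds on all of [R], not only on [I], so derivatives of [e * u] pass to [y] by plain
       extensionality. *)
    assert (Hyu : forall x, (e x * u x)%C = y x).
    { intros x; unfold e, u; rewrite Cmult_assoc, Cexp_opp_mult; ring. }
    assert (HeF : forall x, (e x * (Cexp (P x) * F x))%C = F x).
    { intros x; unfold e; rewrite Cmult_assoc, Cexp_opp_mult; ring. }
    exists (fun x => - (B x / 2) * e x * u x + e x * du x)%C.
    (* The second derivative of [y] is left open and filled in by the product rule. *)
    eexists; split; [|split].
    + intros x Hx.
      apply is_derive_ext with (fun x => e x * u x)%C; [exact Hyu|].
      apply is_derive_RC_mult; [now apply He | now apply Hu].
    + intros x Hx; cbv beta.
      apply is_derive_RC_plus.
      * apply is_derive_RC_mult; [|now apply Hu].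
        apply is_derive_RC_mult; [|now apply He].
        apply is_derive_RC_opp.
        apply is_derive_RC_mult; [now apply HB | apply is_derive_RC_const].
      * apply is_derive_RC_mult; [now apply He | now apply Hdu].
    + intros x Hx; cbv beta.
      transitivity (e x * (Cexp (P x) * F x))%C; [|apply HeF].
      rewrite <- (Hyu x), (HQ' x Hx); field.
Qed.

(** With real coefficients, the real part of the equation involves only [Re (dy x)] and
    [Re (ddy x)], so the complex derivatives need not be shown real first. *)
Lemma solves_real_RtoC (I : R -> Prop) (B Q F y : R -> R) :
  solves_real I B Q F y <->
  solves_complex I (fun x => RtoC (B x)) (fun x => RtoC (Q x))
    (fun x => RtoC (F x)) (fun x => RtoC (y x)).
Proof.
  split.
  - intros (dy & ddy & Hy & Hdy & Heq).
    exists (fun x => RtoC (dy x)), (fun x => RtoC (ddy x)).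
    split; [|split]; intros x Hx.
    + now apply is_derive_RC_RtoC, Hy.
    + now apply is_derive_RC_RtoC, Hdy.
    + now rewrite <- !RtoC_mult, <- !RtoC_plus, Heq.
  - intros (dy & ddy & Hy & Hdy & Heq).
    exists (fun x => Re (dy x)), (fun x => Re (ddy x)).
    split; [|split]; intros x Hx.
    + exact (proj1 (proj1 (is_derive_RC_iff _ _ _) (Hy x Hx))).
    + exact (proj1 (proj1 (is_derive_RC_iff _ _ _) (Hdy x Hx))).
    + pose proof (f_equal Re (Heq x Hx)) as H; cbn in H.
      unfold Re in *; lra.
Qed.

(** * The general solution, over the complex numbers and then over the reals *)

Lemma general_solution_complex (a b : Rbar) (B dB Q F P G S y : R -> C)
    (c : C) :
  has_derivative_on C_R_NormedModule (Rbar_ointerval a b) B dB ->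
  (forall x : R, Rbar_ointerval a b x ->
     ((B x) ^ 2 + 2 * dB x - 4 * Q x = 0)%C) ->
  (forall x : R, Rbar_ointerval a b x -> (x + c <> 0)%C) ->
  has_derivative_on C_R_NormedModule (Rbar_ointerval a b)
    P (fun x => (B x / 2)%C) ->
  has_derivative_on C_R_NormedModule (Rbar_ointerval a b)
    G (fun x => ((x + c) * Cexp (P x) * F x)%C) ->
  has_derivative_on C_R_NormedModule (Rbar_ointerval a b)
    S (fun x => (1 / (x + c) ^ 2 * G x)%C) ->
  solves_complex (Rbar_ointerval a b) B Q F y <->
  exists C1 C2 : C, forall x : R, Rbar_ointerval a b x ->
    y x = ((x + c) * Cexp (- P x) * S x
           + C1 * Cexp (- P x) + C2 * x * Cexp (- P x))%C.
Proof.
  intros HB HQ Hc HP HG HS.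
  set (I := Rbar_ointerval a b) in *.
  assert (Hxc : forall x, is_derive_RC (fun t => (t + c)%C) x (RtoC 1)).
  { intros x; apply is_derive_RC_eq with (1 + 0)%C; [|ring].
    apply is_derive_RC_plus; [apply is_derive_RC_id|apply is_derive_RC_const]. }
  set (v := fun x : R => ((x + c) * S x)%C).
  set (dv := fun x : R => (S x + G x * / (x + c))%C).
  assert (Hv : has_derivative_on C_R_NormedModule I v dv).
  { intros x Hx; eapply is_derive_RC_eq.
    - apply is_derive_RC_mult; [apply Hxc | now apply HS].
    - unfold dv; field; now apply Hc. }
  assert (Hdv : has_derivative_on C_R_NormedModule I dv
    (fun x => (Cexp (P x) * F x)%C)).
  (* [S'] contributes [G / (x + c)^2], which cancels against the derivative of [1 / (x + c)] in the
     second summand. *)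
  { intros x Hx; eapply is_derive_RC_eq.
    - apply is_derive_RC_plus; [now apply HS|].
      apply is_derive_RC_mult; [now apply HG|].
      apply is_derive_RC_inv; [apply Hxc | now apply Hc].
    - cbv beta; field; now apply Hc. }
  rewrite (solves_complex_substitution I B dB Q F P y HB HQ HP).
  split.
  - intros (du & Hu & Hdu).
    destruct (second_derivative_zero_affine a b
      (fun x => Cexp (P x) * y x - v x)%C (fun x => du x - dv x)%C
      (* The zero second derivative is left uncancelled, in the form the difference rule
         produces. *)
      (fun x => Cexp (P x) * F x - Cexp (P x) * F x)%C) as (C1 & C2 & H).
    + intros x Hx; apply is_derive_RC_minus; [now apply Hu | now apply Hv].
    + intros x Hx; apply is_derive_RC_minus; [now apply Hdu | now apply Hdv].
    + intros x _; ring.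
    + exists C1, C2; intros x Hx.
      transitivity (Cexp (- P x) * Cexp (P x) * y x)%C.
      { rewrite Cexp_opp_mult; ring. }
      transitivity (Cexp (- P x) * (v x + (Cexp (P x) * y x - v x)))%C;
        [ring|].
      rewrite (H x Hx); unfold v; ring.
  - intros (C1 & C2 & H).
    assert (Hvu : forall x, I x ->
      (v x + (C1 + C2 * x) = Cexp (P x) * y x)%C).
    { intros x Hx; rewrite (H x Hx).
      transitivity (Cexp (- P x) * Cexp (P x) * (v x + (C1 + C2 * x)))%C;
        [rewrite Cexp_opp_mult; ring | unfold v; ring]. }
    exists (fun x => dv x + C2)%C; split; intros x Hx.
    (* The formula for [y] is known only on the interval, so the two functions agree merely near
       [x]; openness makes this enough. *)
    + apply is_derive_ext_loc with (fun x => v x + (C1 + C2 * x))%C.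
      * apply locally_interval with a b; [apply Hx | apply Hx |].
        intros t Hat Htb; exact (Hvu t (conj Hat Htb)).
      * apply is_derive_RC_plus; [now apply Hv|].
        apply is_derive_RC_eq with (0 + (0 * x + C2 * 1))%C; [|ring].
        apply is_derive_RC_plus; [apply is_derive_RC_const|].
        apply is_derive_RC_mult; [apply is_derive_RC_const|].
        apply is_derive_RC_id.
    + eapply is_derive_RC_eq.
      * apply is_derive_RC_plus; [now apply Hdv | apply is_derive_RC_const].
      * ring.
Qed.

Lemma general_solution_real (a b : Rbar) (B dB Q F P G S y : R -> R)
    (c : R) :
  has_derivative_on R_NormedModule (Rbar_ointerval a b) B dB ->
  (forall x : R, Rbar_ointerval a b x ->
     (B x) ^ 2 + 2 * dB x - 4 * Q x = 0) ->
  (forall x : R, Rbar_ointerval a b x -> x + c <> 0) ->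
  has_derivative_on R_NormedModule (Rbar_ointerval a b)
    P (fun x => B x / 2) ->
  has_derivative_on R_NormedModule (Rbar_ointerval a b)
    G (fun x => (x + c) * exp (P x) * F x) ->
  has_derivative_on R_NormedModule (Rbar_ointerval a b)
    S (fun x => 1 / (x + c) ^ 2 * G x) ->
  solves_real (Rbar_ointerval a b) B Q F y <->
  exists C1 C2 : R, forall x : R, Rbar_ointerval a b x ->
    y x = (x + c) * exp (- P x) * S x
          + C1 * exp (- P x) + C2 * x * exp (- P x).
Proof.
  intros HB HQ Hc HP HG HS.
  rewrite solves_real_RtoC.
  rewrite (general_solution_complex a b (fun x => RtoC (B x))
    (fun x => RtoC (dB x)) (fun x => RtoC (Q x)) (fun x => RtoC (F x))
    (fun x => RtoC (P x)) (fun x => RtoC (G x)) (fun x => RtoC (S x))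
    (fun x => RtoC (y x)) (RtoC c)).
  - assert (Hexp : forall x, Cexp (- RtoC (P x)) = RtoC (exp (- P x))).
    { intros x; now rewrite <- RtoC_opp, Cexp_RtoC. }
    split; intros (C1 & C2 & H).
    (* All other factors are real, so taking real parts only replaces the constants by theirs. *)
    + exists (Re C1), (Re C2); intros x Hx.
      pose proof (f_equal Re (H x Hx)) as HR; rewrite Hexp in HR.
      cbn in HR; unfold Re; rewrite HR; ring.
    + exists (RtoC C1), (RtoC C2); intros x Hx.
      now rewrite Hexp, (H x Hx), !RtoC_plus, !RtoC_mult, RtoC_plus.
  (* What remains are the hypotheses of the complex case, reached by pulling [RtoC] out of each
     expression. *)
  - intros x Hx; now apply is_derive_RC_RtoC, HB.
  - intros x Hx; cbv beta.
    rewrite <- RtoC_pow, <- !RtoC_mult, <- RtoC_plus, <- RtoC_minus.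
    now rewrite (HQ x Hx).
  - intros x Hx; rewrite <- RtoC_plus; now apply RtoC_neq_0, Hc.
  - intros x Hx; cbv beta; rewrite <- RtoC_div by lra.
    now apply is_derive_RC_RtoC, HP.
  - intros x Hx; cbv beta; rewrite Cexp_RtoC, <- RtoC_plus, <- !RtoC_mult.
    now apply is_derive_RC_RtoC, HG.
  - intros x Hx; cbv beta.
    rewrite <- RtoC_plus, <- RtoC_pow, <- RtoC_div, <- RtoC_mult
      by now apply pow_nonzero, Hc.
    now apply is_derive_RC_RtoC, HS.
Qed.

Lemma is_derive_continuous (V : NormedModule R_AbsRing) (f : R -> V) (x : R)
    (l : V) :
  is_derive f x l -> continuous f x.
Proof. intros H; apply ex_derive_continuous; now exists l. Qed.

(* Q and F are the coefficient C and the right-hand side R of the equation;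
   P, G, S are the fixed antiderivatives denoted by the three integrals
     P = int B/2,  G = int (x+c) e^P F,  S = int G/(x+c)^2.
   First conjunct: K = R; second conjunct: K = C. *)
Theorem corollary1 (a b : Rbar) :
  (forall (B dB Q F : R -> R) (c : R),
     has_derivative_on R_NormedModule (Rbar_ointerval a b) B dB ->
     (forall x : R, Rbar_ointerval a b x ->
        (B x) ^ 2 + 2 * dB x - 4 * Q x = 0) ->
     (forall x : R, Rbar_ointerval a b x -> x + c <> 0) ->
     (exists P : R -> R,
        has_derivative_on R_NormedModule (Rbar_ointerval a b)
          P (fun x => B x / 2)) /\
     (forall P : R -> R,
        has_derivative_on R_NormedModule (Rbar_ointerval a b)
          P (fun x => B x / 2) ->
        forall G : R -> R,
        has_derivative_on R_NormedModule (Rbar_ointerval a b)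
          G (fun x => (x + c) * exp (P x) * F x) ->
        (exists S : R -> R,
           has_derivative_on R_NormedModule (Rbar_ointerval a b)
             S (fun x => 1 / (x + c) ^ 2 * G x)) /\
        (forall S : R -> R,
           has_derivative_on R_NormedModule (Rbar_ointerval a b)
             S (fun x => 1 / (x + c) ^ 2 * G x) ->
           forall y : R -> R,
           solves_real (Rbar_ointerval a b) B Q F y <->
           exists C1 C2 : R, forall x : R, Rbar_ointerval a b x ->
             y x = (x + c) * exp (- P x) * S x
                   + C1 * exp (- P x) + C2 * x * exp (- P x))))
  /\
  (forall (B dB Q F : R -> C) (c : C),
     has_derivative_on C_R_NormedModule (Rbar_ointerval a b) B dB ->
     (forall x : R, Rbar_ointerval a b x ->
        ((B x) ^ 2 + 2 * dB x - 4 * Q x = 0)%C) ->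
     (forall x : R, Rbar_ointerval a b x -> (x + c <> 0)%C) ->
     (exists P : R -> C,
        has_derivative_on C_R_NormedModule (Rbar_ointerval a b)
          P (fun x => (B x / 2)%C)) /\
     (forall P : R -> C,
        has_derivative_on C_R_NormedModule (Rbar_ointerval a b)
          P (fun x => (B x / 2)%C) ->
        forall G : R -> C,
        has_derivative_on C_R_NormedModule (Rbar_ointerval a b)
          G (fun x => ((x + c) * Cexp (P x) * F x)%C) ->
        (exists S : R -> C,
           has_derivative_on C_R_NormedModule (Rbar_ointerval a b)
             S (fun x => (1 / (x + c) ^ 2 * G x)%C)) /\
        (forall S : R -> C,
           has_derivative_on C_R_NormedModule (Rbar_ointerval a b)
             S (fun x => (1 / (x + c) ^ 2 * G x)%C) ->
           forall y : R -> C,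
           solves_complex (Rbar_ointerval a b) B Q F y <->
           exists C1 C2 : C, forall x : R, Rbar_ointerval a b x ->
             y x = ((x + c) * Cexp (- P x) * S x
                    + C1 * Cexp (- P x) + C2 * x * Cexp (- P x))%C))).
Proof.
  split.
  - intros B dB Q F c HB HQ Hc; split.
    + apply (antiderivative_exists a b R_CompleteNormedModule).
      intros x Hx; specialize (HB x Hx).
      apply is_derive_continuous with (dB x / 2).
      auto_derive_from_hyps; field.
    + intros P HP G HG; split.
      * apply (antiderivative_exists a b R_CompleteNormedModule).
        intros x Hx; specialize (HG x Hx); specialize (Hc x Hx).
        apply (ex_derive_continuous (V := R_NormedModule)); auto_derive.
        repeat split; [nra | eexists; exact HG].
      * intros S HS y.
        now apply (general_solution_real a b B dB Q F P G S y c).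
  - intros B dB Q F c HB HQ Hc; split.
    + apply (antiderivative_exists a b C_R_CompleteNormedModule).
      (* [B x / 2] unfolds to the product of [B x] and the constant [/ 2]. *)
      intros x Hx; eapply is_derive_continuous, is_derive_RC_mult.
      * now apply HB.
      * apply is_derive_RC_const.
    + intros P HP G HG; split.
      * apply (antiderivative_exists a b C_R_CompleteNormedModule).
        intros x Hx.
        eapply is_derive_continuous, is_derive_RC_mult; [|now apply HG].
        apply is_derive_RC_mult; [apply is_derive_RC_const|].
        apply is_derive_RC_inv; [|now apply Cpow_nz, Hc].
        assert (Hxc : is_derive_RC (fun t => (t + c)%C) x (1 + 0)%C)
          by (apply is_derive_RC_plus;
              [apply is_derive_RC_id | apply is_derive_RC_const]).
        (* [(t + c) ^ 2] unfolds to [(t + c) * ((t + c) * 1)], hence two product rules and a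
           constant factor. *)
        apply is_derive_RC_mult; [exact Hxc|].
        apply is_derive_RC_mult; [exact Hxc | apply is_derive_RC_const].
      * intros S HS y.
        now apply (general_solution_complex a b B dB Q F P G S y c).
Qed.
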